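(* Let $(\mathscr V_0,\mathscr V_1)$ be an interpolation couple, let $s\in(0,1)$, $u\in[\mathscr V_0,\mathscr V_1]_s$, and for $t\in\mathbb R^+$ let $v(t)\in\mathscr V_1$ be the minimizer of the K-functional $\mathrm K^2_{(\mathscr V_0,\mathscr V_1)}(t;u)$. Then $$\mathcal L_{\mathrm K^s(\mathscr V_0,\mathscr V_1)}u=\int_0^\infty t^{-2s-1}\big(u-v(t)\big)\,dt .$$
   Context: An interpolation couple $(\mathscr V_0,\mathscr V_1)$ is a pair of Hilbert spaces with norms $\|\cdot\|_0,\|\cdot\|_1$ and inner products $\langle\cdot,\cdot\rangle_0,\langle\cdot,\cdot\rangle_1$ such that $\mathscr V_1\subset\mathscr V_0$ is dense with compact embedding. There is then an orthonormal basis $(\varphi_k)_{k=1}^\infty$ of $\mathscr V_0$ and a sequence $\lambda_k^2\in\mathbb R^+$, $\lambda_k^2\to\infty$, with $\langle\varphi_k,v\rangle_1=\lambda_k^2\langle\varphi_k,v\rangle_0$ for all $v\in\mathscr V_1$ and $k\in\mathbb N$. For $s\in(0,1)$ the interpolation space is $[\mathscr V_0,\mathscr V_1]_s:=\{u\in\mathscr V_0:\ \sum_{k=1}^\infty\lambda_k^{2s}\langle u,\varphi_k\rangle_0^2<\infty\}$. For $u\in\mathscr V_0$ and $t\in\mathbb R^+$, the K-functional is $\mathrm K^2_{(\mathscr V_0,\mathscr V_1)}(t;u):=\inf_{v\in\mathscr V_1}\|u-v\|_0^2+t^2\|v\|_1^2$. Its minimizer $v(t)$ is the unique solution in $\mathscr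 V_1$ of $\langle v(t),w\rangle_0+t^2\langle v(t),w\rangle_1=\langle u,w\rangle_0$ for all $w\in\mathscr V_1$, and $v(t)=\sum_{k=1}^\infty\frac{\langle u,\varphi_k\rangle_0}{1+t^2\lambda_k^2}\varphi_k$. The K-norm is $\|u\|^2_{\mathrm K^s(\mathscr V_0,\mathscr V_1)}:=\int_0^\infty t^{-2s-1}\mathrm K^2_{(\mathscr V_0,\mathscr V_1)}(t;u)\,dt$, with induced inner product $\langle\cdot,\cdot\rangle_{\mathrm K^s(\mathscr V_0,\mathscr V_1)}$. The K-interpolation operator is defined as the unique operator $\mathcal L_{\mathrm K^s(\mathscr V_0,\mathscr V_1)}:[\mathscr V_0,\mathscr V_1]_s\to\mathscr V_0$ that satisfies $\langle w,\mathcal L_{\mathrm K^s(\mathscr V_0,\mathscr V_1)}u\rangle_0=\langle w,u\rangle_{\mathrm K^s(\mathscr V_0,\mathscr V_1)}$ for all $w\in\mathscr V_1$.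
   Formalization: L u need not lie in V0 for every u in [V0,V1]_s, so the identity is proved tested against every w in V1, and in V0 as: f = L u iff the improper integral converges in V0 to f. *)

(* Defs.v *)
From Stdlib Require Import Reals.
From Coquelicot Require Import Coquelicot.
Open Scope R_scope.

(** Real Hilbert spaces: the inner product induces the norm of a complete
    normed module, so positive definiteness follows from [norm_eq_zero]. *)
Record HilbertSpace := {
  hilbert_carrier :> CompleteNormedModule R_AbsRing;
  inner : hilbert_carrier -> hilbert_carrier -> R;
  inner_sym : forall x y, inner x y = inner y x;
  inner_plus_l : forall x y z, inner (plus x y) z = inner x z + inner y z;
  inner_scal_l : forall (a : R) x y, inner (scal a x) y = a * inner x y;
  inner_norm : forall x, inner x x = norm x ^ 2
}.

Arguments inner {h} _ _.

(** The inclusion of [V1] in [V0] is an injective bounded linear map [emb].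
    Compactness is sequential. *)
Record InterpolationCouple := {
  V0 : HilbertSpace;
  V1 : HilbertSpace;
  emb : V1 -> V0;
  emb_linear : is_linear emb;
  emb_inj : forall x y, emb x = emb y -> x = y;
  emb_dense : forall (u : V0) (eps : posreal),
    exists v : V1, norm (minus u (emb v)) < eps;
  emb_compact : forall x : nat -> V1,
    (exists M : R, forall n, norm (x n) <= M) ->
    exists (sub : nat -> nat) (u : V0),
      (forall n, (sub n < sub (S n))%nat) /\
      filterlim (fun n => emb (x (sub n))) eventually (locally u)
}.

Arguments emb {i} _.

Section Couple.

Variable C : InterpolationCouple.

(** The eigenbasis lies in [V1], since the pairing of [phi k] in the inner
    product of [V1] must make sense; [lam k] is the positive root. *)
Record is_eigenbasis (phi : nat -> V1 C) (lam : nat -> R) : Prop := {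
  eigen_orthonormal : forall j k,
    inner (emb (phi j)) (emb (phi k)) = if Nat.eqb j k then 1 else 0;
  eigen_basis : forall u : V0 C,
    is_series (fun k => scal (inner u (emb (phi k))) (emb (phi k))) u;
  eigen_pos : forall k, 0 < lam k;
  eigen_lim : is_lim_seq (fun k => lam k ^ 2) p_infty;
  eigen_eq : forall k (v : V1 C),
    inner (phi k) v = lam k ^ 2 * inner (emb (phi k)) (emb v)
}.

Definition in_interpolation_space (phi : nat -> V1 C) (lam : nat -> R)
    (s : R) (u : V0 C) : Prop :=
  ex_series (fun k => Rpower (lam k) (2 * s) * inner u (emb (phi k)) ^ 2).

Definition K_objective (t : R) (u : V0 C) (v : V1 C) : R :=
  norm (minus u (emb v)) ^ 2 + t ^ 2 * norm v ^ 2.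

(** The square of the K-functional; the infimum is over a nonempty set bounded
    below by [0], hence finite. *)
Definition K2 (t : R) (u : V0 C) : R :=
  real (Glb_Rbar (fun r => exists v : V1 C, r = K_objective t u v)).

Definition is_K_minimizer (t : R) (u : V0 C) (v : V1 C) : Prop :=
  forall w : V1 C, K_objective t u v <= K_objective t u w.

(** The square of the K-norm; the integrand is nonnegative, so the improper
    Riemann integral over (0, oo) is the usual integral. *)
Definition K_norm2 (s : R) (u : V0 C) : R :=
  RInt_gen (fun t => Rpower t (- 2 * s - 1) * K2 t u)
    (at_right 0) (Rbar_locally p_infty).

(** Inner product induced by the K-norm, through polarization. *)
Definition K_inner (s : R) (w u : V0 C) : R :=
  (K_norm2 s (plus w u) - K_norm2 s (minus w u)) / 4.

(** The K-interpolation operator applied to [u], as a functional on [V1].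
    For [u] in the interpolation space of order [s] it lies in the dual of [V1],
    but need not be represented by an element of [V0]. *)
Definition K_operator_dual (s : R) (u : V0 C) : V1 C -> R :=
  fun w => K_inner s (emb w) u.

(** Graph of the K-interpolation operator with values in [V0]: [f] is the
    unique element of [V0] representing [K_operator_dual s u]. *)
Definition is_K_operator (s : R) (u f : V0 C) : Prop :=
  unique (fun g : V0 C => forall w : V1 C, inner (emb w) g = K_inner s (emb w) u) f.

End Couple.

Arguments is_eigenbasis {C} _ _.
Arguments in_interpolation_space {C} _ _ _ _.
Arguments K_objective {C} _ _ _.
Arguments K2 {C} _ _.
Arguments is_K_minimizer {C} _ _ _.
Arguments K_norm2 {C} _ _.
Arguments K_inner {C} _ _ _.
Arguments K_operator_dual {C} _ _ _.
Arguments is_K_operator {C} _ _ _.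

(* Main.v *)
Require Import Defs.
From Stdlib Require Import Reals Lra Lia.
From Coquelicot Require Import Coquelicot.
Open Scope R_scope.

(** Testing the infimum with the truncations [sum_(k <= N) a_k / (1 + t^2 lam_k^2) phi_k],
    and bounding it below with the Bessel inequality in [V1], gives
    [K2 t a = sum_k h_k(t) a_k^2] with [h_k(t) = t^2 lam_k^2 / (1 + t^2 lam_k^2)], without
    constructing a minimizer for [a]. The Euler-Lagrange equation of the given minimizer
    for [u] says that [u - v(t)] has coefficients [h_k(t) u_k], so [<w, u - v(t)>] is
    [(K2 t (w + u) - K2 t (w - u)) / 4]: the integrand of the weak identity is the
    polarization of the integrand of the K-norm, and only the convergence of the K-norm
    integrals of [w + u] and [w - u] is needed, no interchange of sum and integral.

    In [V0], the partial integrals of [t^(-2s-1) (u - v(t))] have coefficients between [0]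
    and those of [f], each converging to that of [f]; since the coefficients of [f] are
    square summable, dominated convergence for series gives convergence in norm. *)

(** * Inner products and linear maps *)

(* [ring] needs the carrier to be syntactically [R], not a projection of a
   Coquelicot structure. *)
Ltac Rring :=
  repeat change (@plus _ ?x ?y) with (Rplus x y);
  match goal with |- @eq _ ?x ?y => change (@eq R x y) end; ring.

Lemma inner_plus_r (H : HilbertSpace) (x y z : H) :
  inner x (plus y z) = inner x y + inner x z.
Proof. now rewrite inner_sym, inner_plus_l, (inner_sym _ y), (inner_sym _ z). Qed.

Lemma inner_scal_r (H : HilbertSpace) (a : R) (x y : H) :
  inner x (scal a y) = a * inner x y.
Proof. now rewrite inner_sym, inner_scal_l, inner_sym. Qed.

Lemma inner_opp_l (H : HilbertSpace) (x y : H) : inner (opp x) y = - inner x y.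
Proof.
transitivity (inner (scal (opp one) x : H) y).
- f_equal. symmetry. apply (scal_opp_one x).
- rewrite inner_scal_l. change (opp one) with (- (1)). ring.
Qed.

Lemma inner_minus_l (H : HilbertSpace) (x y z : H) :
  inner (minus x y) z = inner x z - inner y z.
Proof. unfold minus. rewrite inner_plus_l, inner_opp_l. ring. Qed.

Lemma inner_minus_r (H : HilbertSpace) (x y z : H) :
  inner x (minus y z) = inner x y - inner x z.
Proof. now rewrite inner_sym, inner_minus_l, (inner_sym _ y), (inner_sym _ z). Qed.

Lemma inner_zero_l (H : HilbertSpace) (x : H) : inner zero x = 0.
Proof.
transitivity (inner (minus x x) x).
- f_equal. symmetry. apply (minus_eq_zero x).
- rewrite inner_minus_l. ring.
Qed.

Lemma inner_self_ge_0 (H : HilbertSpace) (x : H) : 0 <= inner x x.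
Proof. rewrite inner_norm. apply pow2_ge_0. Qed.

Lemma norm_minus_sqr (H : HilbertSpace) (x y : H) :
  norm (minus x y) ^ 2 = norm x ^ 2 - 2 * inner x y + norm y ^ 2.
Proof.
rewrite <- !inner_norm, inner_minus_l, !inner_minus_r, (inner_sym _ y x). ring.
Qed.

Lemma Cauchy_Schwarz (H : HilbertSpace) (x y : H) :
  Rabs (inner x y) <= norm x * norm y.
Proof.
assert (Hx := norm_ge_0 x). assert (Hy := norm_ge_0 y).
assert (Hsq : inner x y ^ 2 <= norm x ^ 2 * norm y ^ 2).
{ destruct (Req_dec (norm y) 0) as [E | E].
  - rewrite (norm_eq_zero y E), inner_sym, inner_zero_l.
    assert (0 <= norm x ^ 2 * norm (zero : H) ^ 2) by nra. nra.
  (* The squared norm of this vector is [norm y ^ 2] times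
     [norm x ^ 2 * norm y ^ 2 - inner x y ^ 2]. *)
  - assert (P := inner_self_ge_0 H (minus (scal (norm y ^ 2) x) (scal (inner x y) y))).
    rewrite inner_minus_l, !inner_minus_r, !inner_scal_l, !inner_scal_r in P.
    rewrite !inner_norm, (inner_sym _ y x) in P.
    assert (0 < norm y ^ 2) by nra. nra. }
rewrite <- (Rabs_pos_eq (norm x * norm y)) by nra.
apply Rsqr_le_abs_0. unfold Rsqr. nra.
Qed.

Lemma is_linear_inner (H : HilbertSpace) (x : H) : is_linear (inner x).
Proof.
split.
- intros y z. apply inner_plus_r.
- intros k y. apply inner_scal_r.
(* The bound required by [is_linear] is strictly positive, whereas [norm x] may vanish. *)
- exists (norm x + 1). assert (Hx := norm_ge_0 x). split; [lra |].
  intros y. assert (Hy := norm_ge_0 y).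
  apply Rle_trans with (1 := Cauchy_Schwarz H x y). nra.
Qed.

Lemma linear_sum_n (U V : NormedModule R_AbsRing) (l : U -> V) (a : nat -> U) (N : nat) :
  is_linear l -> l (sum_n a N) = sum_n (fun k => l (a k)) N.
Proof.
intros Hl. induction N as [|N IH].
- now rewrite !sum_O.
- now rewrite !sum_Sn, (linear_plus _ Hl), IH.
Qed.

Lemma is_series_linear (U V : NormedModule R_AbsRing) (l : U -> V) (a : nat -> U) (x : U) :
  is_linear l -> is_series a x -> is_series (fun k => l (a k)) (l x).
Proof.
intros Hl Ha.
apply filterlim_ext with (fun N => l (sum_n a N)).
- intros N. now apply linear_sum_n.
- apply filterlim_comp with (1 := Ha). now apply linear_cont.
Qed.

(** A linear map commutes with Riemann sums, by induction on the pointed subdivision; its continuity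
    then carries the limit over. *)
Lemma is_RInt_linear (U V : NormedModule R_AbsRing) (l : U -> V) (f : R -> U)
    (a b : R) (I : U) :
  is_linear l -> is_RInt f a b I -> is_RInt (fun t => l (f t)) a b (l I).
Proof.
intros Hl Hf. unfold is_RInt in *.
apply filterlim_ext with (fun p => l (scal (sign (b - a)) (Riemann_sum f p))).
- intros p. rewrite (linear_scal _ Hl). f_equal.
  apply SF_cons_ind with (s := p).
  + intros x. unfold Riemann_sum; simpl. exact (linear_zero l Hl).
  + intros h s IH. rewrite !Riemann_sum_cons, <- IH.
    etransitivity; [apply (linear_plus l Hl) |].
    apply (f_equal2 plus); [apply (linear_scal l Hl) | reflexivity].
- apply filterlim_comp with (1 := Hf). now apply linear_cont.
Qed.

Lemma is_RInt_gen_linear (U V : NormedModule R_AbsRing) (l : U -> V) (f : R -> U)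
    (Fa Fb : (R -> Prop) -> Prop) (I : U) :
  Filter Fa -> Filter Fb -> is_linear l ->
  is_RInt_gen f Fa Fb I -> is_RInt_gen (fun t => l (f t)) Fa Fb (l I).
Proof.
intros FFa FFb Hl Hf P HP.
assert (HF : Filter (filter_prod Fa Fb)) by now apply filter_prod_filter.
generalize (Hf _ (linear_cont l I Hl P HP)).
unfold filtermapi, filtermap. apply filter_imp.
intros ab [J [HJ HPJ]]. exists (l J). split; [| exact HPJ].
now apply is_RInt_linear.
Qed.

(** * Finite sums and orthogonal families *)

Lemma sum_n_ge_0 (a : nat -> R) (N : nat) : (forall k, 0 <= a k) -> 0 <= sum_n a N.
Proof.
intros Ha. induction N as [|N IH].
- now rewrite sum_O.
- rewrite sum_Sn. change plus with Rplus. specialize (Ha (S N)). lra.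
Qed.

Lemma sum_n_le (a b : nat -> R) (N : nat) :
  (forall k, a k <= b k) -> sum_n a N <= sum_n b N.
Proof. intros Hab. now apply sum_n_m_le. Qed.

Lemma sum_n_le_series (a : nat -> R) (l : R) (N : nat) :
  (forall k, 0 <= a k) -> is_series a l -> sum_n a N <= l.
Proof.
intros Ha Hl.
assert (Hm : forall n, sum_n a n <= sum_n a (S n)).
{ intros n. rewrite sum_Sn. change plus with Rplus. specialize (Ha (S n)). lra. }
exact (is_lim_seq_incr_compare _ _ Hl Hm N).
Qed.

Definition lincomb {H : HilbertSpace} (b : nat -> R) (psi : nat -> H) (N : nat) : H :=
  sum_n (fun k => scal (b k) (psi k)) N.

Lemma lincomb_S (H : HilbertSpace) (b : nat -> R) (psi : nat -> H) (N : nat) :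
  lincomb b psi (S N) = plus (lincomb b psi N) (scal (b (S N)) (psi (S N))).
Proof. apply (sum_Sn (fun k => scal (b k) (psi k))). Qed.

(** The squared lengths [d] are left free so that the lemma serves both in [V0], with [d = 1], and
    in [V1], with [d k = lam k ^ 2]. *)
Lemma norm_lincomb_orthogonal (H : HilbertSpace) (psi : nat -> H) (d : nat -> R)
    (b : nat -> R) (N : nat) :
  (forall j k, inner (psi j) (psi k) = if Nat.eqb j k then d j else 0) ->
  norm (lincomb b psi N) ^ 2 =
  sum_n (fun k => b k ^ 2 * d k) N.
Proof.
intros Hpsi.
assert (Hoff : forall m n, (n < m)%nat ->
  inner (psi m) (lincomb b psi n) = 0).
{ intros m n Hmn. induction n as [|n IH].
  - unfold lincomb. rewrite sum_O, inner_scal_r, Hpsi.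
    destruct (Nat.eqb_spec m 0); [lia | ring].
  - rewrite lincomb_S, inner_plus_r, IH by lia. rewrite inner_scal_r, Hpsi.
    destruct (Nat.eqb_spec m (S n)); [lia | ring]. }
rewrite <- inner_norm. induction N as [|N IH].
- unfold lincomb. rewrite !sum_O, inner_scal_r, inner_scal_l, Hpsi. simpl. ring.
- rewrite lincomb_S, sum_Sn, inner_plus_l, !inner_plus_r, IH.
  rewrite (inner_sym _ _ (scal (b (S N)) (psi (S N)))), !inner_scal_l.
  rewrite inner_scal_r, Hoff, Hpsi, Nat.eqb_refl by lia.
  change plus with Rplus. ring.
Qed.

Lemma inner_lincomb (H : HilbertSpace) (psi : nat -> H) (b : nat -> R) (x : H) (N : nat) :
  inner x (lincomb b psi N) =
  sum_n (fun k => b k * inner x (psi k)) N.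
Proof.
unfold lincomb. rewrite (linear_sum_n _ _ _ _ _ (is_linear_inner H x)).
apply sum_n_ext. intros k. apply inner_scal_r.
Qed.

(** Expand the square of the distance from [x] to the partial sum with its own Fourier coefficients
    [c]. These are given by a multiplied-out equation, which avoids division by [d k]. *)
Lemma Bessel_orthogonal (H : HilbertSpace) (psi : nat -> H) (d c : nat -> R) (x : H) (N : nat) :
  (forall j k, inner (psi j) (psi k) = if Nat.eqb j k then d j else 0) ->
  (forall k, inner (psi k) x = d k * c k) ->
  sum_n (fun k => d k * c k ^ 2) N <= norm x ^ 2.
Proof.
intros Hpsi Hc.
assert (P := pow2_ge_0 (norm (minus x (lincomb c psi N)))).
rewrite norm_minus_sqr, (norm_lincomb_orthogonal _ _ _ _ _ Hpsi), inner_lincomb in P.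
rewrite (sum_n_ext (fun k => c k * inner x (psi k)) (fun k => d k * c k ^ 2)) in P
  by (intros k; rewrite inner_sym, Hc; Rring).
rewrite (sum_n_ext (fun k => c k ^ 2 * d k) (fun k => d k * c k ^ 2)) in P
  by (intros k; Rring).
lra.
Qed.

(** * Spectral form of the K-functional *)

Lemma is_series_le (a b : nat -> R) (l m : R) :
  (forall k, a k <= b k) -> is_series a l -> is_series b m -> l <= m.
Proof.
intros Hab Ha Hb.
exact (is_lim_seq_le _ _ l m (fun N => sum_n_le a b N Hab) Ha Hb).
Qed.

Lemma Parseval (C : InterpolationCouple) (phi : nat -> V1 C) (lam : nat -> R)
    (Hbasis : is_eigenbasis phi lam) (x y : V0 C) :
  is_series (fun k => inner x (emb (phi k)) * inner y (emb (phi k))) (inner x y).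
Proof.
rewrite inner_sym.
generalize (is_series_linear _ _ _ _ _ (is_linear_inner _ y) (eigen_basis _ _ _ Hbasis x)).
apply is_series_ext. intros k. apply inner_scal_r.
Qed.

Lemma Parseval_norm (C : InterpolationCouple) (phi : nat -> V1 C) (lam : nat -> R)
    (Hbasis : is_eigenbasis phi lam) (x : V0 C) :
  is_series (fun k => inner x (emb (phi k)) ^ 2) (norm x ^ 2).
Proof.
rewrite <- inner_norm. generalize (Parseval C phi lam Hbasis x x).
apply is_series_ext. intros k. Rring.
Qed.

Lemma eigenbasis_orthogonal_V1 (C : InterpolationCouple) (phi : nat -> V1 C)
    (lam : nat -> R) (Hbasis : is_eigenbasis phi lam) (j k : nat) :
  inner (phi j) (phi k) = if Nat.eqb j k then lam j ^ 2 else 0.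
Proof.
rewrite (eigen_eq _ _ _ Hbasis), (eigen_orthonormal _ _ _ Hbasis).
destruct (Nat.eqb j k); ring.
Qed.

(** By the eigenvalue equation, the Fourier coefficients of [v] along [phi] in [V1] coincide with
    those of [emb v] in [V0]. *)
Lemma Bessel_V1 (C : InterpolationCouple) (phi : nat -> V1 C) (lam : nat -> R)
    (Hbasis : is_eigenbasis phi lam) (v : V1 C) (N : nat) :
  sum_n (fun k => lam k ^ 2 * inner (emb v) (emb (phi k)) ^ 2) N <= norm v ^ 2.
Proof.
apply (Bessel_orthogonal _ phi).
- apply (eigenbasis_orthogonal_V1 C phi lam Hbasis).
- intros k. rewrite (eigen_eq _ _ _ Hbasis). f_equal. apply inner_sym.
Qed.

(** This is the minimum over real [y] of [(1 - y)^2 + t^2 l^2 y^2], the K-functional of a single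
    mode, attained at [y = 1 / (1 + t^2 l^2)]. *)
Definition K_weight (l t : R) : R := t ^ 2 * l ^ 2 / (1 + t ^ 2 * l ^ 2).

Lemma one_plus_sqr_pos (l t : R) : 0 < 1 + t ^ 2 * l ^ 2.
Proof. assert (H := pow2_ge_0 (t * l)). nra. Qed.

Lemma K_weight_ge_0 (l t : R) : 0 <= K_weight l t.
Proof.
apply Rdiv_le_0_compat; [| apply one_plus_sqr_pos].
assert (H := pow2_ge_0 (t * l)). nra.
Qed.

Lemma K_weight_compl (l t : R) : 1 - K_weight l t = / (1 + t ^ 2 * l ^ 2).
Proof.
assert (H := one_plus_sqr_pos l t). unfold K_weight. field. lra.
Qed.

Lemma K_objective_ge_sum (C : InterpolationCouple) (phi : nat -> V1 C) (lam : nat -> R)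
    (Hbasis : is_eigenbasis phi lam) (t : R) (a : V0 C) (v : V1 C) (N : nat) :
  sum_n (fun k => K_weight (lam k) t * inner a (emb (phi k)) ^ 2) N <= K_objective t a v.
Proof.
assert (H0 : sum_n (fun k => inner (minus a (emb v)) (emb (phi k)) ^ 2) N
             <= norm (minus a (emb v)) ^ 2).
{ apply sum_n_le_series; [intros k; apply pow2_ge_0 |].
  now apply Parseval_norm with lam. }
assert (H1 := Bessel_V1 C phi lam Hbasis v N).
unfold K_objective.
apply Rle_trans with
  (sum_n (fun k => inner (minus a (emb v)) (emb (phi k)) ^ 2) N
   + t ^ 2 * sum_n (fun k => lam k ^ 2 * inner (emb v) (emb (phi k)) ^ 2) N).
2: { assert (H := pow2_ge_0 t). nra. }
rewrite <- (sum_n_mult_l (K := R_Ring) (t ^ 2)).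
change Rplus with (@plus R_AbelianMonoid). rewrite <- sum_n_plus.
apply sum_n_le. intros k. rewrite inner_minus_l.
change plus with Rplus. change mult with Rmult.
set (x := inner a _). set (y := inner (emb v) _).
assert (Hq := one_plus_sqr_pos (lam k) t).
unfold K_weight. apply Rmult_le_reg_l with (1 := Hq).
replace ((1 + t ^ 2 * lam k ^ 2) * (t ^ 2 * lam k ^ 2 / (1 + t ^ 2 * lam k ^ 2) * x ^ 2))
  with (t ^ 2 * lam k ^ 2 * x ^ 2) by (field; lra).
(* With [q = t^2 lam^2], completing the square gives [(1 + q) ((x - y)^2 + q y^2) - q x^2 = (x - (1
   + q) y)^2]. *)
assert (P := pow2_ge_0 (x - (1 + t ^ 2 * lam k ^ 2) * y)). nra.
Qed.

Lemma emb_lincomb (C : InterpolationCouple) (b : nat -> R) (psi : nat -> V1 C) (N : nat) :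
  emb (lincomb b psi N) = lincomb b (fun k => emb (psi k)) N.
Proof.
etransitivity; [apply (linear_sum_n _ _ _ _ _ (emb_linear C)) |].
apply (sum_n_ext (G := V0 C)). intros k. apply (linear_scal _ (emb_linear C)).
Qed.

Definition K_trial (C : InterpolationCouple) (phi : nat -> V1 C) (lam : nat -> R)
    (t : R) (a : V0 C) (N : nat) : V1 C :=
  lincomb (fun k => inner a (emb (phi k)) / (1 + t ^ 2 * lam k ^ 2)) phi N.

(** Each mode up to [N] attains its scalar minimum; the modes beyond [N] are not approximated at all
    and contribute the Parseval tail of [a]. *)
Lemma K_objective_trial (C : InterpolationCouple) (phi : nat -> V1 C) (lam : nat -> R)
    (Hbasis : is_eigenbasis phi lam) (t : R) (a : V0 C) (N : nat) :
  K_objective t a (K_trial C phi lam t a N) =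
  norm a ^ 2 - sum_n (fun k => inner a (emb (phi k)) ^ 2) N
  + sum_n (fun k => K_weight (lam k) t * inner a (emb (phi k)) ^ 2) N.
Proof.
unfold K_objective, K_trial. set (b := fun k => inner a (emb (phi k)) / (1 + t ^ 2 * lam k ^ 2)).
rewrite (norm_lincomb_orthogonal _ phi (fun k => lam k ^ 2))
  by apply (eigenbasis_orthogonal_V1 C phi lam Hbasis).
rewrite emb_lincomb.
rewrite norm_minus_sqr, (norm_lincomb_orthogonal _ _ (fun _ => 1)), inner_lincomb
  by apply (eigen_orthonormal _ _ _ Hbasis).
set (c := fun k => inner a (emb (phi k))).
assert (E : - (2 * sum_n (fun k => b k * c k) N) + sum_n (fun k => b k ^ 2 * 1) N
  + t ^ 2 * sum_n (fun k => b k ^ 2 * lam k ^ 2) N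
  = - sum_n (fun k => c k ^ 2) N + sum_n (fun k => K_weight (lam k) t * c k ^ 2) N).
2: { unfold c in E. lra. }
assert (T : forall k, - (2 * (b k * c k)) + b k ^ 2 * 1 + t ^ 2 * (b k ^ 2 * lam k ^ 2)
  = - c k ^ 2 + K_weight (lam k) t * c k ^ 2).
{ intros k. assert (Hq := one_plus_sqr_pos (lam k) t).
  unfold b, c, K_weight. field. lra. }
clearbody b c. induction N as [|N IH].
- rewrite !sum_O. specialize (T 0%nat). lra.
- rewrite !sum_Sn. change plus with Rplus. specialize (T (S N)). lra.
Qed.

(** The two hypotheses together keep [Glb_Rbar] finite, so that [real] does not fall back on its
    default value. *)
Lemma K2_bounds (C : InterpolationCouple) (t lo hi : R) (a : V0 C) :
  (forall v : V1 C, lo <= K_objective t a v) ->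
  (exists v : V1 C, K_objective t a v <= hi) -> lo <= K2 t a <= hi.
Proof.
intros Hlo [v Hv]. unfold K2.
destruct (Glb_Rbar_correct (fun r => exists v, r = K_objective t a v)) as [H1 H2].
assert (L : Rbar_le lo (Glb_Rbar (fun r => exists v, r = K_objective t a v))).
{ apply H2. intros r [w ->]. apply Hlo. }
assert (U := H1 _ (ex_intro _ v eq_refl)).
destruct (Glb_Rbar _) as [g | |]; simpl in *; [lra | easy | easy].
Qed.

Lemma K2_le_sum (C : InterpolationCouple) (phi : nat -> V1 C) (lam : nat -> R)
    (Hbasis : is_eigenbasis phi lam) (t : R) (a : V0 C) (N : nat) :
  K2 t a <= norm a ^ 2 - sum_n (fun k => inner a (emb (phi k)) ^ 2) N
  + sum_n (fun k => K_weight (lam k) t * inner a (emb (phi k)) ^ 2) N.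
Proof.
apply (K2_bounds C t (sum_n (fun k => K_weight (lam k) t * inner a (emb (phi k)) ^ 2) N)).
- intros v. now apply K_objective_ge_sum.
- exists (K_trial C phi lam t a N). now rewrite (K_objective_trial C phi lam Hbasis); right.
Qed.

Lemma K2_ge_sum (C : InterpolationCouple) (phi : nat -> V1 C) (lam : nat -> R)
    (Hbasis : is_eigenbasis phi lam) (t : R) (a : V0 C) (N : nat) :
  sum_n (fun k => K_weight (lam k) t * inner a (emb (phi k)) ^ 2) N <= K2 t a.
Proof.
(* Only the lower bound is wanted here; the competitor [zero] serves to make the infimum finite. *)
apply (K2_bounds C t _ (K_objective t a zero)).
- intros v. now apply K_objective_ge_sum.
- exists zero. apply Rle_refl.
Qed.

(** The partial sums are squeezed between [K2 t a] minus the Parseval tail of [a] and [K2 t a]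
    itself. *)
Lemma is_series_K2 (C : InterpolationCouple) (phi : nat -> V1 C) (lam : nat -> R)
    (Hbasis : is_eigenbasis phi lam) (t : R) (a : V0 C) :
  is_series (fun k => K_weight (lam k) t * inner a (emb (phi k)) ^ 2) (K2 t a).
Proof.
change (is_lim_seq (sum_n (fun k => K_weight (lam k) t * inner a (emb (phi k)) ^ 2)) (K2 t a)).
apply is_lim_seq_le_le with
  (u := fun N => K2 t a - (norm a ^ 2 - sum_n (fun k => inner a (emb (phi k)) ^ 2) N))
  (w := fun _ => K2 t a).
- intros N. split; [| now apply K2_ge_sum].
  assert (H := K2_le_sum C phi lam Hbasis t a N). lra.
- replace (Finite (K2 t a)) with (Finite (K2 t a - (norm a ^ 2 - norm a ^ 2)))
    by (f_equal; ring).
  apply is_lim_seq_minus'; [apply is_lim_seq_const |].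
  apply is_lim_seq_minus'; [apply is_lim_seq_const |].
  exact (Parseval_norm C phi lam Hbasis a).
- apply is_lim_seq_const.
Qed.

Lemma K2_ge_0 (C : InterpolationCouple) (phi : nat -> V1 C) (lam : nat -> R)
    (Hbasis : is_eigenbasis phi lam) (t : R) (a : V0 C) : 0 <= K2 t a.
Proof.
apply Rle_trans with (2 := K2_ge_sum C phi lam Hbasis t a 0).
apply sum_n_ge_0. intros k.
apply Rmult_le_pos; [apply K_weight_ge_0 | apply pow2_ge_0].
Qed.

(** The difference is [t'^2 - t^2] times [l^2 / ((1 + t^2 l^2) (1 + t'^2 l^2))], and that factor is
    at most [1 / t^2]. The bound is uniform in [l], so it can be summed over all modes. *)
Lemma K_weight_dist (l t t' : R) :
  0 < t -> Rabs (K_weight l t' - K_weight l t) <= Rabs (t' ^ 2 - t ^ 2) / t ^ 2.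
Proof.
intros Ht.
assert (H := one_plus_sqr_pos l t). assert (H' := one_plus_sqr_pos l t').
assert (Hl := pow2_ge_0 l). assert (Ht2 : 0 < t ^ 2) by nra.
assert (Hx' : 0 <= t' ^ 2 * l ^ 2) by (assert (P := pow2_ge_0 t'); nra).
replace (K_weight l t' - K_weight l t) with
  ((t' ^ 2 - t ^ 2) * (l ^ 2 / ((1 + t ^ 2 * l ^ 2) * (1 + t' ^ 2 * l ^ 2))))
  by (unfold K_weight; field; lra).
rewrite Rabs_mult. unfold Rdiv at 2. apply Rmult_le_compat_l; [apply Rabs_pos |].
rewrite Rabs_pos_eq.
- apply Rmult_le_reg_r with (t ^ 2); [exact Ht2 |].
  rewrite Rinv_l by lra.
  replace (l ^ 2 / ((1 + t ^ 2 * l ^ 2) * (1 + t' ^ 2 * l ^ 2)) * t ^ 2) with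
    ((t ^ 2 * l ^ 2) / ((1 + t ^ 2 * l ^ 2) * (1 + t' ^ 2 * l ^ 2))) by (field; lra).
  apply Rle_div_l; nra.
- apply Rdiv_le_0_compat; nra.
Qed.

(** The modulus is asked for at positive [t'] only, since minimizers are given only there; these
    form a neighbourhood of [t]. *)
Lemma continuous_of_modulus (V : NormedModule R_AbsRing) (f : R -> V) (g : R -> R) (t : R) :
  continuous g t -> g t = 0 -> (forall t', 0 < t' -> norm (minus (f t') (f t)) <= g t') ->
  0 < t -> continuous f t.
Proof.
intros Hg Hg0 Hfg Ht. apply filterlim_locally. intros eps.
assert (Hlo : locally t (fun y => 0 < y)) by now apply open_gt.
assert (H := filter_and _ _ (proj1 (filterlim_locally _ _) Hg eps) Hlo).
revert H. apply filter_imp. intros y [Hy Hy0].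
apply norm_compat1. apply Rle_lt_trans with (1 := Hfg y Hy0).
rewrite Hg0 in Hy. change (Rabs (g y - 0) < eps) in Hy.
rewrite Rminus_0_r in Hy. apply Rle_lt_trans with (2 := Hy). apply Rle_abs.
Qed.

Lemma continuous_sqr_modulus (c t : R) :
  continuous (fun t' => c * (Rabs (t' ^ 2 - t ^ 2) / t ^ 2)) t.
Proof.
apply (continuous_scal_r (V := R_NormedModule) c
  (fun t' => Rabs (t' ^ 2 - t ^ 2) / t ^ 2)).
apply (continuous_scal_l (V := R_NormedModule) (fun t' => Rabs (t' ^ 2 - t ^ 2)) (/ t ^ 2)).
apply (continuous_comp (fun t' => t' ^ 2 - t ^ 2) Rabs); [| apply continuous_Rabs].
apply (ex_derive_continuous (fun t' => t' ^ 2 - t ^ 2)). auto_derive. exact I.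
Qed.

(** The modulus of [K_weight_dist] is the same for every mode, so comparing the series of [K2] at
    [t] and [t'] costs that modulus times the Parseval sum [norm a ^ 2]. *)
Lemma K2_continuous (C : InterpolationCouple) (phi : nat -> V1 C) (lam : nat -> R)
    (Hbasis : is_eigenbasis phi lam) (a : V0 C) (t : R) :
  0 < t -> continuous (fun t => K2 t a) t.
Proof.
intros Ht.
apply continuous_of_modulus with (fun t' => norm a ^ 2 * (Rabs (t' ^ 2 - t ^ 2) / t ^ 2)).
- apply continuous_sqr_modulus.
- rewrite Rminus_diag, Rabs_R0. field. lra.
- intros t' _. change (Rabs (K2 t' a - K2 t a) <= norm a ^ 2 * (Rabs (t' ^ 2 - t ^ 2) / t ^ 2)).
  set (c := Rabs (t' ^ 2 - t ^ 2) / t ^ 2).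
  assert (HP := is_series_scal c _ _ (Parseval_norm C phi lam Hbasis a)).
  assert (HD : forall k, Rabs (K_weight (lam k) t' - K_weight (lam k) t) <= c)
    by (intros k; now apply K_weight_dist).
  rewrite Rmult_comm. apply Rabs_le_between'. split.
  + apply Rle_minus_l.
    refine (is_series_le _ _ _ _ _ (is_series_K2 C phi lam Hbasis t a)
      (is_series_plus _ _ _ _ (is_series_K2 C phi lam Hbasis t' a) HP)).
    intros k. specialize (HD k). apply Rabs_le_between' in HD.
    change (plus ?x (scal ?y ?z)) with (x + y * z).
    assert (Q := pow2_ge_0 (inner a (emb (phi k)))). nra.
  + refine (is_series_le _ _ _ _ _ (is_series_K2 C phi lam Hbasis t' a)
      (is_series_plus _ _ _ _ (is_series_K2 C phi lam Hbasis t a) HP)).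
    intros k. specialize (HD k). apply Rabs_le_between' in HD.
    change (plus ?x (scal ?y ?z)) with (x + y * z).
    assert (Q := pow2_ge_0 (inner a (emb (phi k)))). nra.
- exact Ht.
Qed.

(** * Improper integrals of nonnegative functions *)

Lemma filter_prod_0_infty_intro (P : R * R -> Prop) (a0 b0 : R) :
  0 < a0 -> (forall a b, 0 < a < a0 -> b0 < b -> P (a, b)) ->
  filter_prod (at_right 0) (Rbar_locally p_infty) P.
Proof.
intros Ha0 HP.
apply Filter_prod with (fun a => 0 < a < a0) (fun b => b0 < b).
- exists (mkposreal a0 Ha0). intros a Hball Ha. split; [exact Ha |].
  change (Rabs (a - 0) < a0) in Hball. rewrite Rminus_0_r in Hball.
  now apply Rle_lt_trans with (1 := Rle_abs a).
- now exists b0.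
- exact HP.
Qed.

Lemma filter_prod_0_infty_elim (P : R * R -> Prop) :
  filter_prod (at_right 0) (Rbar_locally p_infty) P ->
  exists a0 b0, 0 < a0 /\ (forall a b, 0 < a < a0 -> b0 < b -> P (a, b)).
Proof.
intros [Q S [d HQ] [b0 HS] HP].
exists d, b0. split; [apply cond_pos |]. intros a b Ha Hb. apply HP; [| now apply HS].
apply HQ; [| easy]. change (Rabs (a - 0) < d). rewrite Rminus_0_r, Rabs_pos_eq; lra.
Qed.

Lemma RInt_subset_le (f : R -> R) (a b a' b' : R) :
  (forall t, 0 < t -> 0 <= f t) ->
  (forall a b, 0 < a -> a <= b -> ex_RInt f a b) ->
  0 < a' -> a' <= a -> a <= b -> b <= b' -> RInt f a b <= RInt f a' b'.
Proof.
intros Hf Hex Ha' Haa Hab Hbb.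
rewrite <- (RInt_Chasles f a' a b') by (apply Hex; lra).
rewrite <- (RInt_Chasles f a b b') by (apply Hex; lra).
assert (0 <= RInt f a' a).
{ apply RInt_ge_0; [lra | apply Hex; lra |]. intros t Ht. apply Hf; lra. }
assert (0 <= RInt f b b').
{ apply RInt_ge_0; [lra | apply Hex; lra |]. intros t Ht. apply Hf; lra. }
change plus with Rplus. lra.
Qed.

(** For nonnegative [f] the integral grows with the interval, so the supremum over compact intervals
    is the limit. *)
Lemma ex_RInt_gen_bounded (f : R -> R) (M : R) :
  (forall t, 0 < t -> 0 <= f t) ->
  (forall a b, 0 < a -> a <= b -> ex_RInt f a b) ->
  (forall a b, 0 < a -> a <= b -> RInt f a b <= M) ->
  ex_RInt_gen f (at_right 0) (Rbar_locally p_infty).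
Proof.
intros Hf Hex HM.
destruct (completeness (fun r => exists a b, 0 < a /\ a <= b /\ r = RInt f a b))
  as [l [Hub Hleast]].
- exists M. intros r (a & b & Ha & Hab & ->). now apply HM.
- exists (RInt f 1 1), 1, 1. repeat split; lra.
- exists l. apply (proj2 (filterlimi_locally _ _)). intros eps.
  assert (Hnear : exists a b, 0 < a /\ a <= b /\ l - eps < RInt f a b).
  { apply Classical_Prop.NNPP. intros Hn.
    assert (l <= l - eps); [| destruct eps; simpl in *; lra].
    apply Hleast. intros r (a & b & Ha & Hab & ->).
    apply Rnot_lt_le. intros Hlt. apply Hn. now exists a, b. }
  destruct Hnear as (a & b & Ha & Hab & Hlt).
  apply filter_prod_0_infty_intro with a b; [exact Ha |].
  intros a' b' Ha' Hb'. exists (RInt f a' b'). split.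
  + apply (RInt_correct f). apply Hex; simpl; lra.
  + change (Rabs (RInt f a' b' - l) < eps).
    assert (H1 : RInt f a b <= RInt f a' b') by (apply RInt_subset_le; trivial; lra).
    assert (H2 : RInt f a' b' <= l) by (apply Hub; exists a', b'; repeat split; lra).
    apply Rabs_def1; destruct eps; simpl in *; lra.
Qed.

Lemma RInt_le_RInt_gen (f : R -> R) (l a b : R) :
  (forall t, 0 < t -> 0 <= f t) ->
  (forall a b, 0 < a -> a <= b -> ex_RInt f a b) ->
  is_RInt_gen f (at_right 0) (Rbar_locally p_infty) l ->
  0 < a -> a <= b -> RInt f a b <= l.
Proof.
intros Hf Hex Hl Ha Hab. apply le_epsilon. intros eps Heps.
destruct (filter_prod_0_infty_elim _ (proj1 (filterlimi_locally _ _) Hl (mkposreal eps Heps)))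
  as (a0 & b0 & Ha0 & H).
(* An interval that contains [[a, b]] and lies strictly past both thresholds, so its integral is
   within [eps] of [l]. *)
destruct (H (Rmin (a0 / 2) a) (Rmax (b0 + 1) b)) as (I & HI & Hball).
- split; [apply Rmin_glb_lt; lra |]. apply Rle_lt_trans with (1 := Rmin_l _ _). lra.
- apply Rlt_le_trans with (2 := Rmax_l _ _). lra.
- simpl in HI. assert (HI' := is_RInt_unique f _ _ I HI). change (Rabs (I - l) < eps) in Hball.
  assert (Hm : RInt f a b <= RInt f (Rmin (a0 / 2) a) (Rmax (b0 + 1) b)).
  { apply RInt_subset_le; trivial.
    - apply Rmin_glb_lt; lra.
    - apply Rmin_r.
    - apply Rmax_r. }
  apply Rabs_def2 in Hball. lra.
Qed.

(** * Convergence of the K-norm integral *)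

Lemma Rpower_continuous (e t : R) : 0 < t -> continuous (fun t => Rpower t e) t.
Proof.
intros Ht. apply (ex_derive_continuous (fun t => Rpower t e)). unfold Rpower. auto_derive. lra.
Qed.

Lemma K_weight_continuous (l t : R) : continuous (K_weight l) t.
Proof.
apply (ex_derive_continuous (K_weight l)). unfold K_weight. auto_derive.
assert (H := one_plus_sqr_pos l t). simpl in H. lra.
Qed.

Lemma continuous_Rmult (f g : R -> R) (t : R) :
  continuous f t -> continuous g t -> continuous (fun t => f t * g t) t.
Proof. apply (continuous_mult f g). Qed.

Lemma ex_RInt_of_continuous (V : CompleteNormedModule R_AbsRing) (f : R -> V) (a b : R) :
  (forall t, 0 < t -> continuous f t) -> 0 < a -> a <= b -> ex_RInt f a b.
Proof.
intros Hf Ha Hab. apply ex_RInt_continuous. intros t Ht. apply Hf.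
rewrite Rmin_left in Ht; lra.
Qed.

Lemma exp_le_compat (x y : R) : x <= y -> exp x <= exp y.
Proof.
intros [H | ->]; [left; now apply exp_increasing | apply Rle_refl].
Qed.

Lemma Rpower_ge_base (x y : R) : 0 < x <= 1 -> y <= 1 -> x <= Rpower x y.
Proof.
intros [Hx Hx1] Hy. rewrite <- (Rpower_1 x Hx) at 1. unfold Rpower.
apply exp_le_compat. assert (ln x <= 0).
{ rewrite <- ln_1. destruct Hx1 as [H | ->]; [left; now apply ln_increasing | right; reflexivity]. }
nra.
Qed.

(* With [Q = 1 + t^2 l^2] and [y = K_weight l t = 1 - 1/Q], this is the derivative of
   [l^(2s) / 2 * (y^(1-s) / (1-s) - Q^(-s) / s)]. It equals
   [t^(-2s-1) y ((1-y)^(1-s) + y^s)], which dominates [t^(-2s-1) y]. *)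
Definition K_majorant (s l t : R) : R :=
  Rpower t (- 2 * s - 1) * K_weight l t *
  (Rpower (1 - K_weight l t) (1 - s) + Rpower (K_weight l t) s).

Definition K_majorant_primitive (s l t : R) : R :=
  Rpower l (2 * s) / 2 *
  (Rpower (K_weight l t) (1 - s) / (1 - s) - Rpower (1 + t ^ 2 * l ^ 2) (- s) / s).

Lemma K_weight_pos (l t : R) : 0 < l -> 0 < t -> 0 < K_weight l t < 1.
Proof.
intros Hl Ht. assert (H := one_plus_sqr_pos l t).
assert (0 < t ^ 2 * l ^ 2) by (apply Rmult_lt_0_compat; nra).
unfold K_weight. split.
- apply Rdiv_lt_0_compat; lra.
- apply Rlt_div_l; lra.
Qed.

(** On [(0, 1]] a power with exponent at most [1] is at least its base, so the bracket is at least
    [(1 - y) + y = 1], with [y = K_weight l t]. *)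
Lemma K_majorant_ge (s l t : R) :
  0 < s < 1 -> 0 < l -> 0 < t ->
  Rpower t (- 2 * s - 1) * K_weight l t <= K_majorant s l t.
Proof.
intros Hs Hl Ht. assert (Hw := K_weight_pos l t Hl Ht).
assert (Hp : 0 < Rpower t (- 2 * s - 1)) by apply exp_pos.
unfold K_majorant.
assert (1 <= Rpower (1 - K_weight l t) (1 - s) + Rpower (K_weight l t) s).
{ assert (H1 := Rpower_ge_base (1 - K_weight l t) (1 - s)).
  assert (H2 := Rpower_ge_base (K_weight l t) s). lra. }
assert (0 < Rpower t (- 2 * s - 1) * K_weight l t) by (apply Rmult_lt_0_compat; lra).
nra.
Qed.

Lemma is_derive_K_majorant_primitive (s l t : R) :
  0 < s < 1 -> 0 < l -> 0 < t ->
  is_derive (K_majorant_primitive s l) t (K_majorant s l t).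
Proof.
intros Hs Hl Ht. assert (Hw := K_weight_pos l t Hl Ht).
assert (Hq := one_plus_sqr_pos l t).
assert (Hln : ln (K_weight l t) = 2 * ln t + 2 * ln l - ln (1 + t ^ 2 * l ^ 2)).
{ unfold K_weight. rewrite ln_div, ln_mult, <- !Rpower_pow by (try apply Rmult_lt_0_compat; nra).
  unfold Rpower. rewrite !ln_exp. simpl INR. ring. }
assert (Hln' : ln (1 - K_weight l t) = - ln (1 + t ^ 2 * l ^ 2)).
{ rewrite K_weight_compl. now apply ln_Rinv. }
(* All real powers are expressed through [A = l^(2s)], [T = t^(2s)] and [B = (1 + t^2 l^2)^s], which
   reduces the final comparison to a rational identity. *)
set (A := exp (2 * s * ln l)). set (T := exp (2 * s * ln t)).
set (B := exp (s * ln (1 + t ^ 2 * l ^ 2))).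
assert (HA : A <> 0) by apply Rgt_not_eq, exp_pos.
assert (HT : T <> 0) by apply Rgt_not_eq, exp_pos.
assert (HB : B <> 0) by apply Rgt_not_eq, exp_pos.
assert (E1 : Rpower (K_weight l t) (1 - s) = K_weight l t * (B / (T * A))).
{ unfold Rpower. rewrite <- (exp_ln (K_weight l t)) at 2 by lra.
  unfold Rdiv, A, B, T. rewrite Hln, <- exp_plus, <- exp_Ropp, <- !exp_plus. f_equal. ring. }
assert (E2 : Rpower (1 + t ^ 2 * l ^ 2) (- s) = / B).
{ unfold Rpower, B. rewrite <- exp_Ropp. f_equal. ring. }
assert (E3 : Rpower t (- 2 * s - 1) = / (T * t)).
{ unfold Rpower, T. rewrite <- (exp_ln t) at 3 by lra. rewrite <- exp_plus, <- exp_Ropp.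
  f_equal. ring. }
assert (E4 : Rpower (1 - K_weight l t) (1 - s) = B / (1 + t ^ 2 * l ^ 2)).
{ unfold Rpower, B, Rdiv. rewrite <- (exp_ln (1 + t ^ 2 * l ^ 2)) at 2 by lra.
  rewrite Hln', <- exp_Ropp, <- exp_plus. f_equal. ring. }
assert (E5 : Rpower (K_weight l t) s = T * A / B).
{ unfold Rpower, A, B, T, Rdiv. rewrite Hln, <- exp_Ropp, <- !exp_plus. f_equal. ring. }
(* The logarithmic derivative of [K_weight l] is [2/t - 2 t l^2 / (1 + t^2 l^2) = 2 / (t (1 + t^2
   l^2))]. *)
assert (H1 : is_derive (fun t => Rpower (K_weight l t) (1 - s)) t
  ((1 - s) * (2 / (t * (1 + t ^ 2 * l ^ 2))) * Rpower (K_weight l t) (1 - s))).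
{ unfold Rpower, K_weight in *. auto_derive.
  - simpl in *. repeat split; try lra.
  - simpl in *. unfold Rdiv. set (E := exp _). field. repeat split; nra. }
assert (H2 : is_derive (fun t => Rpower (1 + t ^ 2 * l ^ 2) (- s)) t
  (- s * (2 * t * l ^ 2 / (1 + t ^ 2 * l ^ 2)) * Rpower (1 + t ^ 2 * l ^ 2) (- s))).
{ unfold Rpower. auto_derive.
  - simpl in *. lra.
  - simpl in *. field. nra. }
apply (is_derive_ext (fun t => Rpower l (2 * s) / 2 *
  (/ (1 - s) * Rpower (K_weight l t) (1 - s) - / s * Rpower (1 + t ^ 2 * l ^ 2) (- s)))).
{ intros x. unfold K_majorant_primitive, Rdiv. Rring. }
replace (K_majorant s l t) with (Rpower l (2 * s) / 2 *
  (/ (1 - s) * ((1 - s) * (2 / (t * (1 + t ^ 2 * l ^ 2))) * Rpower (K_weight l t) (1 - s))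
   - / s * (- s * (2 * t * l ^ 2 / (1 + t ^ 2 * l ^ 2)) * Rpower (1 + t ^ 2 * l ^ 2) (- s)))).
- apply is_derive_scal.
  apply (is_derive_minus (V := R_NormedModule)); now apply is_derive_scal.
- unfold K_majorant. rewrite E1, E2, E3, E4, E5. change (Rpower l (2 * s)) with A.
  clearbody A B T. unfold K_weight. field. repeat split; try lra.
Qed.

Lemma K_majorant_continuous (s l t : R) :
  0 < l -> 0 < t -> continuous (K_majorant s l) t.
Proof.
intros Hl Ht. assert (Hw := K_weight_pos l t Hl Ht).
assert (Hc := K_weight_continuous l t).
unfold K_majorant. apply continuous_Rmult.
- apply continuous_Rmult; [now apply Rpower_continuous | exact Hc].
- apply (continuous_plus (V := R_NormedModule)).
  + apply (continuous_comp (fun t => 1 - K_weight l t) (fun x => Rpower x (1 - s))).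
    * apply (continuous_minus (V := R_NormedModule)); [apply continuous_const | exact Hc].
    * apply Rpower_continuous. lra.
  + apply (continuous_comp (K_weight l) (fun x => Rpower x s)); [exact Hc |].
    apply Rpower_continuous. lra.
Qed.

Lemma Rpower_le_1 (x y : R) : 0 < x -> y * ln x <= 0 -> 0 < Rpower x y <= 1.
Proof.
intros Hx Hy. split; [apply exp_pos |]. rewrite <- exp_0. now apply exp_le_compat.
Qed.

Lemma K_majorant_primitive_bounds (s l t : R) :
  0 < s < 1 -> 0 < l -> 0 < t ->
  - (Rpower l (2 * s) / 2 / s) <= K_majorant_primitive s l t
  <= Rpower l (2 * s) / 2 / (1 - s).
Proof.
intros Hs Hl Ht. assert (Hw := K_weight_pos l t Hl Ht).
assert (HQ : 1 < 1 + t ^ 2 * l ^ 2).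
{ assert (0 < t ^ 2 * l ^ 2) by (apply Rmult_lt_0_compat; nra). lra. }
assert (H1 : 0 < Rpower (K_weight l t) (1 - s) <= 1).
{ apply Rpower_le_1; [lra |].
  assert (ln (K_weight l t) < 0) by (rewrite <- ln_1; apply ln_increasing; lra). nra. }
assert (H2 : 0 < Rpower (1 + t ^ 2 * l ^ 2) (- s) <= 1).
{ apply Rpower_le_1; [lra |].
  assert (0 < ln (1 + t ^ 2 * l ^ 2)) by (rewrite <- ln_1; apply ln_increasing; lra). nra. }
assert (HA : 0 < Rpower l (2 * s)) by apply exp_pos.
unfold K_majorant_primitive.
set (A := Rpower l (2 * s)) in *. set (x := Rpower (K_weight l t) (1 - s)) in *.
set (y := Rpower _ (- s)) in *.
assert (Hi1 : 0 < / (1 - s)) by (apply Rinv_0_lt_compat; lra).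
assert (Hi2 : 0 < / s) by (apply Rinv_0_lt_compat; lra).
unfold Rdiv.
assert (0 <= x * / (1 - s) <= 1 * / (1 - s)) by (split; nra).
assert (0 <= y * / s <= 1 * / s) by (split; nra).
split; nra.
Qed.

(** The right side is the gap between the two bounds on the primitive of the majorant. Its factor
    [l^(2s)] is the weight of the interpolation space, and it does not depend on [a] and [b]. *)
Lemma RInt_K_weight_le (s l a b : R) :
  0 < s < 1 -> 0 < l -> 0 < a -> a <= b ->
  RInt (fun t => Rpower t (- 2 * s - 1) * K_weight l t) a b
  <= Rpower l (2 * s) * ((/ (1 - s) + / s) / 2).
Proof.
intros Hs Hl Ha Hab.
assert (HI : is_RInt (K_majorant s l) a b
  (minus (K_majorant_primitive s l b) (K_majorant_primitive s l a))).
{ apply (is_RInt_derive (V := R_CompleteNormedModule) (K_majorant_primitive s l));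
    intros t Ht; rewrite Rmin_left in Ht by lra.
  - apply is_derive_K_majorant_primitive; lra.
  - apply K_majorant_continuous; lra. }
apply Rle_trans with (RInt (K_majorant s l) a b).
- apply RInt_le; [exact Hab | | now exists (minus (K_majorant_primitive s l b)
    (K_majorant_primitive s l a)) |].
  + apply ex_RInt_of_continuous; trivial. intros t Ht.
    apply continuous_Rmult; [now apply Rpower_continuous | apply K_weight_continuous].
  + intros t Ht. apply K_majorant_ge; lra.
- rewrite (is_RInt_unique (V := R_CompleteNormedModule) _ _ _ _ HI).
  assert (H1 := K_majorant_primitive_bounds s l a Hs Hl Ha).
  assert (H2 := K_majorant_primitive_bounds s l b Hs Hl ltac:(lra)).
  change minus with Rminus. unfold Rdiv in *. lra.
Qed.

Lemma RInt_sum_K_weight_le (s a b : R) (lam c : nat -> R) (N : nat) :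
  0 < s < 1 -> (forall k, 0 < lam k) -> (forall k, 0 <= c k) -> 0 < a -> a <= b ->
  RInt (fun t => Rpower t (- 2 * s - 1) * sum_n (fun k => K_weight (lam k) t * c k) N) a b
  <= (/ (1 - s) + / s) / 2 * sum_n (fun k => Rpower (lam k) (2 * s) * c k) N.
Proof.
intros Hs Hlam Hc Ha Hab.
set (f := fun k t => Rpower t (- 2 * s - 1) * K_weight (lam k) t).
assert (Hf : forall k, ex_RInt (f k) a b).
{ intros k. apply ex_RInt_of_continuous; trivial. intros t Ht.
  apply continuous_Rmult; [now apply Rpower_continuous | apply K_weight_continuous]. }
assert (HI : is_RInt
  (fun t => Rpower t (- 2 * s - 1) * sum_n (fun k => K_weight (lam k) t * c k) N) a b
  (sum_n (fun k => c k * RInt (f k) a b) N)).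
{ assert (Hk : forall k, is_RInt
    (fun t => Rpower t (- 2 * s - 1) * (K_weight (lam k) t * c k)) a b (c k * RInt (f k) a b)).
  { intros k.
    apply (is_RInt_ext (V := R_NormedModule) (fun t => scal (c k) (f k t))).
    - intros t _. unfold f. change (@scal R_AbsRing ?a ?b ?c) with (b * c).
      change scal with Rmult. Rring.
    - apply (is_RInt_scal (V := R_NormedModule)). apply (RInt_correct (f k)), Hf. }
  induction N as [|N IH].
  - rewrite sum_O.
    apply (is_RInt_ext (V := R_NormedModule)) with (2 := Hk 0%nat).
    intros t _. now rewrite sum_O.
  - rewrite sum_Sn.
    apply (is_RInt_ext (V := R_NormedModule)) with
      (2 := is_RInt_plus (V := R_NormedModule) _ _ _ _ _ _ IH (Hk (S N))).
    intros t _. rewrite sum_Sn. Rring. }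
rewrite (is_RInt_unique (V := R_CompleteNormedModule) _ _ _ _ HI).
rewrite <- (sum_n_mult_l (K := R_Ring)).
apply sum_n_le. intros k. change mult with Rmult.
assert (H := RInt_K_weight_le s (lam k) a b Hs (Hlam k) Ha Hab).
unfold f. specialize (Hc k). set (I := RInt _ _ _) in *. nra.
Qed.

(** On a fixed compact interval, [K2] is at most a finite spectral sum plus a Parseval tail that is
    constant in [t]. Integrating and then letting [N] grow removes the tail, whose factor [D] is
    fixed. *)
Lemma RInt_K2_le (C : InterpolationCouple) (phi : nat -> V1 C) (lam : nat -> R)
    (Hbasis : is_eigenbasis phi lam) (s M alpha beta : R) (a : V0 C) :
  0 < s < 1 ->
  (forall N, sum_n (fun k => Rpower (lam k) (2 * s) * inner a (emb (phi k)) ^ 2) N <= M) ->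
  0 < alpha -> alpha <= beta ->
  RInt (fun t => Rpower t (- 2 * s - 1) * K2 t a) alpha beta <= (/ (1 - s) + / s) / 2 * M.
Proof.
intros Hs HM Ha Hab.
set (c := fun k => inner a (emb (phi k)) ^ 2) in *.
set (D := RInt (fun t => Rpower t (- 2 * s - 1)) alpha beta).
assert (HCs : 0 < (/ (1 - s) + / s) / 2).
{ assert (0 < / (1 - s)) by (apply Rinv_0_lt_compat; lra).
  assert (0 < / s) by (apply Rinv_0_lt_compat; lra). lra. }
assert (Hbound : forall N, RInt (fun t => Rpower t (- 2 * s - 1) * K2 t a) alpha beta
  <= (/ (1 - s) + / s) / 2 * M + (norm a ^ 2 - sum_n c N) * D).
{ intros N.
  set (g := fun t => Rpower t (- 2 * s - 1) * sum_n (fun k => K_weight (lam k) t * c k) N).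
  assert (Hg : ex_RInt g alpha beta).
  { apply ex_RInt_of_continuous; trivial. intros t Ht.
    apply continuous_Rmult; [now apply Rpower_continuous |].
    clear g. induction N as [|N IH].
    - apply (continuous_ext (fun t => K_weight (lam 0%nat) t * c 0%nat)).
      + intros x. now rewrite sum_O.
      + apply continuous_Rmult; [apply K_weight_continuous | apply continuous_const].
    - apply (continuous_ext (fun t => sum_n (fun k => K_weight (lam k) t * c k) N
        + K_weight (lam (S N)) t * c (S N))).
      + intros x. now rewrite sum_Sn.
      + apply (continuous_plus (V := R_NormedModule)); [exact IH |].
        apply continuous_Rmult; [apply K_weight_continuous | apply continuous_const]. }
  assert (HD : ex_RInt (fun t => Rpower t (- 2 * s - 1)) alpha beta)
    by (apply ex_RInt_of_continuous; trivial; intros; now apply Rpower_continuous).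
  assert (HI := is_RInt_plus (V := R_NormedModule) _ _ _ _ _ _ (RInt_correct _ _ _ Hg)
    (is_RInt_scal (V := R_NormedModule) _ _ _ (norm a ^ 2 - sum_n c N) _ (RInt_correct _ _ _ HD))).
  apply Rle_trans with (RInt g alpha beta + (norm a ^ 2 - sum_n c N) * D).
  - rewrite <- (is_RInt_unique (V := R_CompleteNormedModule) _ _ _ _ HI
      : _ = RInt g alpha beta + (norm a ^ 2 - sum_n c N) * D).
    apply RInt_le; [exact Hab | | eexists; exact HI |].
    + apply ex_RInt_of_continuous; trivial. intros t Ht.
      apply continuous_Rmult; [now apply Rpower_continuous |].
      now apply K2_continuous with phi lam.
    + intros t Ht. unfold g. change plus with Rplus. change scal with Rmult.
      assert (HK : K2 t a <= norm a ^ 2 - sum_n c N + sum_n (fun k => K_weight (lam k) t * c k) N)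
        by apply (K2_le_sum C phi lam Hbasis).
      assert (Hp : 0 < Rpower t (- 2 * s - 1)) by apply exp_pos. nra.
  - apply Rplus_le_compat_r.
    apply Rle_trans with (1 := RInt_sum_K_weight_le s alpha beta lam c N Hs
      (eigen_pos _ _ _ Hbasis) (fun k => pow2_ge_0 _) Ha Hab).
    apply Rmult_le_compat_l; [lra |]. apply HM. }
assert (HL : is_lim_seq (fun N => (/ (1 - s) + / s) / 2 * M + (norm a ^ 2 - sum_n c N) * D)
  ((/ (1 - s) + / s) / 2 * M + (norm a ^ 2 - norm a ^ 2) * D)).
{ apply is_lim_seq_plus'; [apply is_lim_seq_const |].
  apply is_lim_seq_mult'; [| apply is_lim_seq_const].
  apply is_lim_seq_minus'; [apply is_lim_seq_const |].
  exact (Parseval_norm C phi lam Hbasis a). }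
assert (H := is_lim_seq_le _ _ _ _ Hbound (is_lim_seq_const _) HL). simpl in H.
rewrite Rminus_diag, Rmult_0_l, Rplus_0_r in H. exact H.
Qed.

(** [RInt_gen] is total, so [K_norm2] is known to be the value of the integral only once convergence
    is proved. *)
Lemma is_RInt_gen_K_norm2 (C : InterpolationCouple) (phi : nat -> V1 C) (lam : nat -> R)
    (Hbasis : is_eigenbasis phi lam) (s M : R) (a : V0 C) :
  0 < s < 1 ->
  (forall N, sum_n (fun k => Rpower (lam k) (2 * s) * inner a (emb (phi k)) ^ 2) N <= M) ->
  is_RInt_gen (fun t => Rpower t (- 2 * s - 1) * K2 t a)
    (at_right 0) (Rbar_locally p_infty) (K_norm2 s a).
Proof.
intros Hs HM. apply (RInt_gen_correct (V := R_CompleteNormedModule)).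
apply ex_RInt_gen_bounded with ((/ (1 - s) + / s) / 2 * M).
- intros t _. apply Rmult_le_pos; [left; apply exp_pos |]. now apply K2_ge_0 with phi lam.
- intros b c Hb Hbc. apply ex_RInt_of_continuous; trivial. intros t Ht.
  apply continuous_Rmult; [now apply Rpower_continuous |].
  now apply K2_continuous with phi lam.
- intros b c Hb Hbc. now apply RInt_K2_le with phi lam.
Qed.

(** * The minimizer and the weak identity *)

Lemma quadratic_ge_0_linear_coef (A B : R) :
  0 <= A -> (forall r, 0 <= 2 * r * B + r ^ 2 * A) -> B = 0.
Proof.
(* Close to the minimizer [- B / A] of the quadratic; the [+ 1] also covers [A = 0]. *)
intros HA H. specialize (H (- B / (A + 1))).
assert (E : 2 * (- B / (A + 1)) * B + (- B / (A + 1)) ^ 2 * A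
  = - (B ^ 2 * ((A + 2) / (A + 1) ^ 2))) by (field; lra).
assert (0 < (A + 2) / (A + 1) ^ 2) by (apply Rdiv_lt_0_compat; nra).
rewrite E in H.
assert (B ^ 2 <= 0) by (apply Rmult_le_reg_r with ((A + 2) / (A + 1) ^ 2); lra).
nra.
Qed.

(** Along [v + r w] the increment of the objective is a nonnegative quadratic in [r], and its linear
    coefficient is twice the difference of the two sides. *)
Lemma K_minimizer_Euler_Lagrange (C : InterpolationCouple) (t : R) (u : V0 C) (v w : V1 C) :
  is_K_minimizer t u v -> inner (minus u (emb v)) (emb w) = t ^ 2 * inner v w.
Proof.
intros Hmin. apply Rminus_diag_uniq_sym.
apply (quadratic_ge_0_linear_coef (norm (emb w) ^ 2 + t ^ 2 * norm w ^ 2)).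
- assert (H := pow2_ge_0 (norm (emb w))). assert (H1 := pow2_ge_0 (t * norm w)). nra.
- intros r. specialize (Hmin (plus v (scal r w))). unfold K_objective in Hmin.
  rewrite (linear_plus _ (emb_linear C)), (linear_scal _ (emb_linear C)) in Hmin.
  rewrite !norm_minus_sqr in Hmin. rewrite <- !inner_norm in *.
  rewrite !inner_plus_l, !inner_plus_r, !inner_scal_l, !inner_scal_r in Hmin.
  rewrite inner_minus_l.
  rewrite (inner_sym _ w v), (inner_sym _ (emb w) (emb v)) in Hmin. lra.
Qed.

(** Testing the Euler-Lagrange equation with [phi k] gives [u_k - v_k = t^2 lam_k^2 v_k], which is
    solved for [v_k]. *)
Lemma inner_K_residual (C : InterpolationCouple) (phi : nat -> V1 C) (lam : nat -> R)
    (Hbasis : is_eigenbasis phi lam) (t : R) (u : V0 C) (v : V1 C) (k : nat) :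
  is_K_minimizer t u v ->
  inner (minus u (emb v)) (emb (phi k)) = K_weight (lam k) t * inner u (emb (phi k)).
Proof.
intros Hmin. assert (H := K_minimizer_Euler_Lagrange C t u v (phi k) Hmin).
rewrite inner_minus_l in *.
rewrite inner_sym, (inner_sym _ v), (eigen_eq _ _ _ Hbasis) in H.
rewrite (inner_sym _ (emb (phi k)) (emb v)) in H.
rewrite (inner_sym _ (emb (phi k)) u) in H.
assert (Hq := one_plus_sqr_pos (lam k) t).
assert (Hv : inner (emb v) (emb (phi k)) = inner u (emb (phi k)) / (1 + t ^ 2 * lam k ^ 2)).
{ apply Rmult_eq_reg_r with (1 + t ^ 2 * lam k ^ 2); [| lra].
  unfold Rdiv. rewrite Rmult_assoc, Rinv_l by lra. lra. }
rewrite Hv. unfold K_weight. field. lra.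
Qed.

Lemma inner_residual_polarization (C : InterpolationCouple) (phi : nat -> V1 C)
    (lam : nat -> R) (Hbasis : is_eigenbasis phi lam) (t : R) (u w : V0 C) (v : V1 C) :
  is_K_minimizer t u v ->
  inner w (minus u (emb v)) = (K2 t (plus w u) - K2 t (minus w u)) / 4.
Proof.
intros Hmin.
assert (H1 := Parseval C phi lam Hbasis w (minus u (emb v))).
assert (H2 := is_series_scal (/ 4) _ _ (is_series_minus _ _ _ _
  (is_series_K2 C phi lam Hbasis t (plus w u))
  (is_series_K2 C phi lam Hbasis t (minus w u)))).
apply is_series_unique in H1. apply is_series_unique in H2.
rewrite <- H1. unfold Rdiv. rewrite Rmult_comm.
etransitivity; [| exact H2]. apply Series_ext. intros k.
rewrite (inner_K_residual C phi lam Hbasis t u v k Hmin), inner_plus_l, inner_minus_l.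
set (x := inner w _). set (y := inner u _). set (h := K_weight _ _).
change (x * (h * y) = / 4 * (h * (x + y) ^ 2 - h * (x - y) ^ 2)). field.
Qed.

Lemma norm_K_residual_le (C : InterpolationCouple) (t : R) (u : V0 C) (v : V1 C) :
  is_K_minimizer t u v -> norm (minus u (emb v)) <= norm u.
Proof.
intros Hmin. specialize (Hmin zero). unfold K_objective in Hmin.
assert (E : emb (zero : V1 C) = zero) by apply (linear_zero _ (emb_linear C)).
rewrite E in Hmin. rewrite (norm_minus_sqr _ u zero) in Hmin.
rewrite (inner_sym _ u), inner_zero_l in Hmin.
assert (E0 : norm (zero : V0 C) = 0) by exact (norm_zero (V := V0 C)).
assert (E1 : norm (zero : V1 C) = 0) by exact (norm_zero (V := V1 C)).
rewrite E0, E1 in Hmin.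
assert (P := pow2_ge_0 (t * norm v)).
apply Rsqr_incr_0_var; [unfold Rsqr; nra | apply norm_ge_0].
Qed.

(** Subtract the Euler-Lagrange equations at [t'] and [t], tested with [d = v(t') - v(t)]: [|d|_0^2
    + t'^2 |d|_1^2 = (t^2 - t'^2) <v(t), d>_1]. The last pairing is [<u - v(t), d>_0 / t^2], at most
    [|u|_0 |d|_0 / t^2] in absolute value, and one factor [|d|_0] cancels. *)
Lemma minimizer_continuous (C : InterpolationCouple) (u : V0 C) (v : R -> V1 C) (t : R) :
  (forall t, 0 < t -> is_K_minimizer t u (v t)) -> 0 < t ->
  continuous (fun t => emb (v t)) t.
Proof.
intros Hv Ht.
apply continuous_of_modulus with (fun t' => norm u * (Rabs (t' ^ 2 - t ^ 2) / t ^ 2)).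
- apply continuous_sqr_modulus.
- rewrite Rminus_diag, Rabs_R0. field. lra.
- intros t' Ht'.
  set (d := minus (v t') (v t)).
  assert (Ed : emb d = minus (emb (v t')) (emb (v t)))
    by apply (linear_minus _ _ _ (emb_linear C)).
  enough (Hd : norm (emb d) <= norm u * (Rabs (t' ^ 2 - t ^ 2) / t ^ 2))
    by (rewrite Ed in Hd; exact Hd).
  assert (H := K_minimizer_Euler_Lagrange C t u (v t) d (Hv t Ht)).
  assert (H' := K_minimizer_Euler_Lagrange C t' u (v t') d (Hv t' Ht')).
  assert (Ed0 : norm (emb d) ^ 2 = inner (emb (v t')) (emb d) - inner (emb (v t)) (emb d)).
  { rewrite <- inner_norm, Ed at 1. apply inner_minus_l. }
  assert (Ed1 : norm d ^ 2 = inner (v t') d - inner (v t) d).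
  { rewrite <- inner_norm. unfold d at 1. apply inner_minus_l. }
  assert (HR : Rabs (inner (minus u (emb (v t))) (emb d)) <= norm u * norm (emb d)).
  { apply Rle_trans with (1 := Cauchy_Schwarz _ _ _). apply Rmult_le_compat_r.
    - apply norm_ge_0.
    - apply norm_K_residual_le with t. now apply Hv. }
  assert (Ht2 : 0 < t ^ 2) by nra.
  assert (Hsq : norm (emb d) ^ 2 <=
    Rabs (t' ^ 2 - t ^ 2) / t ^ 2 * (norm u * norm (emb d))).
  { apply Rle_trans with (Rabs (t' ^ 2 - t ^ 2) / t ^ 2 *
      Rabs (inner (minus u (emb (v t))) (emb d))).
    2: { apply Rmult_le_compat_l; [| exact HR].
         apply Rdiv_le_0_compat; [apply Rabs_pos | exact Ht2]. }
    rewrite H, Rabs_mult, (Rabs_pos_eq (t ^ 2)) by lra.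
    replace (Rabs (t' ^ 2 - t ^ 2) / t ^ 2 * (t ^ 2 * Rabs (inner (v t) d))) with
      (Rabs (t' ^ 2 - t ^ 2) * Rabs (inner (v t) d)) by (field; lra).
    rewrite <- Rabs_mult. rewrite inner_minus_l in H, H'.
    assert (P := pow2_ge_0 (t' * norm d)).
    assert (Q := Rabs_maj2 ((t' ^ 2 - t ^ 2) * inner (v t) d)).
    assert (E : t' ^ 2 * norm d ^ 2 = t' ^ 2 * inner (v t') d - t' ^ 2 * inner (v t) d)
      by (rewrite Ed1; ring).
    lra. }
  assert (Hn := norm_ge_0 (emb d)).
  destruct Hn as [Hn | Hn].
  + apply Rmult_le_reg_r with (1 := Hn). lra.
  + rewrite <- Hn. apply Rmult_le_pos; [apply norm_ge_0 |].
    apply Rdiv_le_0_compat; [apply Rabs_pos | exact Ht2].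
- exact Ht.
Qed.

(** * Weighted square sums of coefficients *)

Lemma weighted_coef_bounded (C : InterpolationCouple) (phi : nat -> V1 C) (lam : nat -> R)
    (s : R) (u : V0 C) :
  in_interpolation_space phi lam s u ->
  exists M, forall N,
    sum_n (fun k => Rpower (lam k) (2 * s) * inner u (emb (phi k)) ^ 2) N <= M.
Proof.
intros [M HM]. exists M. intros N. apply sum_n_le_series; [| exact HM].
intros k. apply Rmult_le_pos; [left; apply exp_pos | apply pow2_ge_0].
Qed.

(** [V1] lies in the interpolation space because [lam^(2s) <= 1 + lam^2]; the two terms are
    controlled by Parseval in [V0] and Bessel in [V1]. *)
Lemma weighted_coef_bounded_emb (C : InterpolationCouple) (phi : nat -> V1 C)
    (lam : nat -> R) (Hbasis : is_eigenbasis phi lam) (s : R) (w : V1 C) :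
  0 < s < 1 ->
  exists M, forall N,
    sum_n (fun k => Rpower (lam k) (2 * s) * inner (emb w) (emb (phi k)) ^ 2) N <= M.
Proof.
intros Hs. exists (norm (emb w) ^ 2 + norm w ^ 2). intros N.
assert (H0 : sum_n (fun k => inner (emb w) (emb (phi k)) ^ 2) N <= norm (emb w) ^ 2).
{ apply sum_n_le_series; [intros k; apply pow2_ge_0 |].
  now apply Parseval_norm with lam. }
assert (H1 := Bessel_V1 C phi lam Hbasis w N).
apply Rle_trans with (2 := Rplus_le_compat _ _ _ _ H0 H1).
change Rplus with (@plus R_AbelianMonoid). rewrite <- sum_n_plus.
apply sum_n_le. intros k. change plus with Rplus.
assert (Hl := eigen_pos _ _ _ Hbasis k). assert (P := pow2_ge_0 (inner (emb w) (emb (phi k)))).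
assert (Hw : Rpower (lam k) (2 * s) <= 1 + lam k ^ 2).
{ destruct (Rle_dec (lam k) 1) as [H | H].
  - assert (Hln : ln (lam k) <= 0) by (rewrite <- ln_1; destruct H as [H | ->];
      [left; now apply ln_increasing | right; reflexivity]).
    assert (Hle : 0 < Rpower (lam k) (2 * s) <= 1) by (apply Rpower_le_1; [exact Hl | nra]).
    assert (Q := pow2_ge_0 (lam k)). lra.
  - rewrite <- (Rpower_pow 2 (lam k) Hl).
    assert (Hle : Rpower (lam k) (2 * s) <= Rpower (lam k) (INR 2)).
    { apply Rle_Rpower; [lra |]. simpl. lra. }
    lra. }
nra.
Qed.

(** The coefficient inequality is [(x + y)^2 <= 2 x^2 + 2 y^2] or its variant for [x - y], so one
    lemma covers both arguments of the polarization. *)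
Lemma weighted_coef_bounded_comb (C : InterpolationCouple) (phi : nat -> V1 C) (lam : nat -> R)
    (s : R) (a b c : V0 C) :
  (forall k, inner c (emb (phi k)) ^ 2 <=
     2 * inner a (emb (phi k)) ^ 2 + 2 * inner b (emb (phi k)) ^ 2) ->
  (exists M, forall N,
    sum_n (fun k => Rpower (lam k) (2 * s) * inner a (emb (phi k)) ^ 2) N <= M) ->
  (exists M, forall N,
    sum_n (fun k => Rpower (lam k) (2 * s) * inner b (emb (phi k)) ^ 2) N <= M) ->
  exists M, forall N,
    sum_n (fun k => Rpower (lam k) (2 * s) * inner c (emb (phi k)) ^ 2) N <= M.
Proof.
intros Hc [Ma HMa] [Mb HMb]. exists (2 * Ma + 2 * Mb). intros N.
specialize (HMa N). specialize (HMb N).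
apply Rle_trans with
  (2 * sum_n (fun k => Rpower (lam k) (2 * s) * inner a (emb (phi k)) ^ 2) N
   + 2 * sum_n (fun k => Rpower (lam k) (2 * s) * inner b (emb (phi k)) ^ 2) N); [| lra].
rewrite <- !(sum_n_mult_l (K := R_Ring)).
change Rplus with (@plus R_AbelianMonoid). rewrite <- sum_n_plus.
apply sum_n_le. intros k. change plus with Rplus. change mult with Rmult.
assert (P : 0 < Rpower (lam k) (2 * s)) by apply exp_pos. specialize (Hc k). nra.
Qed.

Lemma is_RInt_gen_K_operator_dual (C : InterpolationCouple) (phi : nat -> V1 C)
    (lam : nat -> R) (Hbasis : is_eigenbasis phi lam) (s : R) (Hs : 0 < s < 1)
    (u : V0 C) (Hu : in_interpolation_space phi lam s u)
    (v : R -> V1 C) (Hv : forall t : R, 0 < t -> is_K_minimizer t u (v t)) (w : V1 C) :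
  is_RInt_gen
    (fun t => inner (emb w) (scal (Rpower t (- 2 * s - 1)) (minus u (emb (v t)))))
    (at_right 0) (Rbar_locally p_infty) (K_operator_dual s u w).
Proof.
apply weighted_coef_bounded in Hu.
assert (Hw := weighted_coef_bounded_emb C phi lam Hbasis s w Hs).
destruct (weighted_coef_bounded_comb C phi lam s (emb w) u (plus (emb w) u)) as [Mp HMp]; trivial.
{ intros k. rewrite inner_plus_l.
  assert (P := pow2_ge_0 (inner (emb w) (emb (phi k)) - inner u (emb (phi k)))). nra. }
destruct (weighted_coef_bounded_comb C phi lam s (emb w) u (minus (emb w) u)) as [Mm HMm]; trivial.
{ intros k. rewrite inner_minus_l.
  assert (P := pow2_ge_0 (inner (emb w) (emb (phi k)) + inner u (emb (phi k)))). nra. }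
assert (HI := is_RInt_gen_scal _ (/ 4) _ (is_RInt_gen_minus _ _ _ _
  (is_RInt_gen_K_norm2 C phi lam Hbasis s Mp _ Hs HMp)
  (is_RInt_gen_K_norm2 C phi lam Hbasis s Mm _ Hs HMm))).
replace (K_operator_dual s u w) with (scal (/ 4) (minus (K_norm2 s (plus (emb w) u))
  (K_norm2 s (minus (emb w) u)))) by (unfold K_operator_dual, K_inner, Rdiv; apply Rmult_comm).
apply (is_RInt_gen_ext (V := R_NormedModule)) with (2 := HI).
(* The thresholds force [0 < a < 1 < b], so every [t] in between is positive and has a minimizer. *)
apply filter_prod_0_infty_intro with 1 1; [lra |].
intros a b Ha Hb t Ht. simpl in Ht. rewrite Rmin_left in Ht by lra.
rewrite inner_scal_r.
rewrite (inner_residual_polarization C phi lam Hbasis t u (emb w) (v t)) by (apply Hv; lra).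
change (/ 4 * (Rpower t (- 2 * s - 1) * K2 t (plus (emb w) u)
  - Rpower t (- 2 * s - 1) * K2 t (minus (emb w) u))
  = Rpower t (- 2 * s - 1) * ((K2 t (plus (emb w) u) - K2 t (minus (emb w) u)) / 4)).
field.
Qed.

(** * The identity in V0 *)

(** [f - g] is orthogonal to the dense range of [emb]: approximating it by [emb w] within [eps]
    gives [|f - g|^2 <= eps |f - g|]. *)
Lemma dense_separates (C : InterpolationCouple) (f g : V0 C) :
  (forall w : V1 C, inner (emb w) f = inner (emb w) g) -> f = g.
Proof.
intros Hfg.
assert (Hn : norm (minus f g) = 0).
{ apply Rle_antisym; [| apply norm_ge_0]. apply le_epsilon. intros eps Heps.
  destruct (emb_dense C (minus f g) (mkposreal eps Heps)) as [w Hw]. simpl in Hw.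
  assert (E : inner (minus (minus f g) (emb w)) (minus f g) = norm (minus f g) ^ 2).
  { rewrite inner_minus_l, (inner_minus_r _ (emb w)), Hfg, inner_norm. ring. }
  assert (CS := Cauchy_Schwarz _ (minus (minus f g) (emb w)) (minus f g)).
  rewrite E in CS. apply Rle_trans with (1 := Rle_abs _) in CS.
  assert (H := norm_ge_0 (minus f g)).
  rewrite Rplus_0_l. destruct H as [H | H]; [| rewrite <- H; lra].
  apply Rmult_le_reg_r with (1 := H). nra. }
apply norm_eq_zero in Hn.
transitivity (plus (minus f g) g).
- unfold minus. rewrite <- plus_assoc.
  transitivity (plus f zero); [symmetry; apply (plus_zero_r f) |].
  f_equal. symmetry. apply (plus_opp_l g).
- rewrite Hn. apply (plus_zero_l g).
Qed.

Lemma is_K_operator_of_inner (C : InterpolationCouple) (s : R) (u f : V0 C) :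
  (forall w : V1 C, inner (emb w) f = K_inner s (emb w) u) -> is_K_operator s u f.
Proof.
intros Hf. split; [exact Hf |].
intros g Hg. apply dense_separates. intros w. now rewrite Hf, Hg.
Qed.

Lemma ex_RInt_gen_K_weight (s l : R) :
  0 < s < 1 -> 0 < l ->
  ex_RInt_gen (fun t => Rpower t (- 2 * s - 1) * K_weight l t)
    (at_right 0) (Rbar_locally p_infty).
Proof.
intros Hs Hl.
apply ex_RInt_gen_bounded with (Rpower l (2 * s) * ((/ (1 - s) + / s) / 2)).
- intros t _. apply Rmult_le_pos; [left; apply exp_pos | apply K_weight_ge_0].
- intros a b Ha Hab. apply ex_RInt_of_continuous; trivial. intros t Ht.
  apply continuous_Rmult; [now apply Rpower_continuous | apply K_weight_continuous].
- intros a b Ha Hab. now apply RInt_K_weight_le.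
Qed.

(** Beyond [N], the coefficients of [x] are dominated by those of [y], and the resulting tail bound
    does not involve [x]. This is the domination step for series. *)
Lemma Parseval_tail_le (C : InterpolationCouple) (phi : nat -> V1 C) (lam : nat -> R)
    (Hbasis : is_eigenbasis phi lam) (x y : V0 C) (N : nat) :
  (forall k, inner x (emb (phi k)) ^ 2 <= inner y (emb (phi k)) ^ 2) ->
  norm x ^ 2 <= sum_n (fun k => inner x (emb (phi k)) ^ 2) N
    + (norm y ^ 2 - sum_n (fun k => inner y (emb (phi k)) ^ 2) N).
Proof.
intros Hxy.
assert (Hs := is_series_minus _ _ _ _ (Parseval_norm C phi lam Hbasis y)
  (Parseval_norm C phi lam Hbasis x)).
assert (Hk : forall k, 0 <= inner y (emb (phi k)) ^ 2 - inner x (emb (phi k)) ^ 2)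
  by (intros k; specialize (Hxy k); lra).
assert (H : sum_n (fun k => inner y (emb (phi k)) ^ 2 - inner x (emb (phi k)) ^ 2) N
  <= norm y ^ 2 - norm x ^ 2) by exact (sum_n_le_series _ _ N Hk Hs).
assert (E : sum_n (fun k => inner y (emb (phi k)) ^ 2 - inner x (emb (phi k)) ^ 2) N
  = sum_n (fun k => inner y (emb (phi k)) ^ 2) N - sum_n (fun k => inner x (emb (phi k)) ^ 2) N).
{ clear. induction N as [|N IH].
  - now rewrite !sum_O.
  - rewrite !sum_Sn, IH. Rring. }
rewrite E in H. lra.
Qed.

Lemma filter_sum_sqr_lt (T : Type) (F : (T -> Prop) -> Prop) (FF : Filter F)
    (c : nat -> R) (e : nat -> T -> R) (N : nat) (eta : R) :
  (forall k eps, 0 < eps -> F (fun x => Rabs (e k x) < eps)) -> 0 < eta ->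
  F (fun x => sum_n (fun k => (c k * e k x) ^ 2) N < eta).
Proof.
intros He.
assert (H1 : forall k eta, 0 < eta -> F (fun x => (c k * e k x) ^ 2 < eta)).
{ intros k eta' Heta'.
  assert (Hc := pow2_ge_0 (c k)).
  (* The [+ 1] keeps the quotient meaningful when [c k] vanishes. *)
  assert (Hpos : 0 < eta' / (c k ^ 2 + 1)) by (apply Rdiv_lt_0_compat; lra).
  generalize (He k _ (sqrt_lt_R0 _ Hpos)). apply filter_imp. intros x Hx.
  assert (Hsq : e k x ^ 2 < eta' / (c k ^ 2 + 1)).
  { rewrite <- (pow2_sqrt (eta' / (c k ^ 2 + 1))) by lra.
    rewrite <- (pow2_abs (e k x)). assert (P := Rabs_pos (e k x)). nra. }
  apply Rlt_div_r in Hsq; [| lra].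
  assert (P := pow2_ge_0 (e k x)). nra. }
revert eta. induction N as [|N IH]; intros eta Heta.
- generalize (H1 0%nat eta Heta). apply filter_imp. intros x. now rewrite sum_O.
- generalize (filter_and (F := F) _ _ (IH (eta / 2) ltac:(lra)) (H1 (S N) (eta / 2) ltac:(lra))).
  apply filter_imp. intros x [Hx Hy]. rewrite sum_Sn. change plus with Rplus. lra.
Qed.

Lemma is_RInt_gen_of_K_operator (C : InterpolationCouple) (phi : nat -> V1 C)
    (lam : nat -> R) (Hbasis : is_eigenbasis phi lam) (s : R) (Hs : 0 < s < 1)
    (u : V0 C) (Hu : in_interpolation_space phi lam s u)
    (v : R -> V1 C) (Hv : forall t : R, 0 < t -> is_K_minimizer t u (v t)) (f : V0 C) :
  (forall w : V1 C, inner (emb w) f = K_inner s (emb w) u) ->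
  is_RInt_gen (fun t => scal (Rpower t (- 2 * s - 1)) (minus u (emb (v t))))
    (at_right 0) (Rbar_locally p_infty) f.
Proof.
intros Hf.
set (G := fun t => scal (Rpower t (- 2 * s - 1)) (minus u (emb (v t)))).
set (g := fun k t => Rpower t (- 2 * s - 1) * K_weight (lam k) t).
set (c := fun k => inner u (emb (phi k))).
set (m := fun k => RInt_gen (g k) (at_right 0) (Rbar_locally p_infty)).
assert (Hm : forall k, is_RInt_gen (g k) (at_right 0) (Rbar_locally p_infty) (m k)).
{ intros k. apply (RInt_gen_correct (V := R_CompleteNormedModule)), ex_RInt_gen_K_weight;
    [exact Hs | apply (eigen_pos _ _ _ Hbasis)]. }
assert (Hg0 : forall k t, 0 < t -> 0 <= g k t).
{ intros k t _. apply Rmult_le_pos; [left; apply exp_pos | apply K_weight_ge_0]. }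
assert (Hgex : forall k a b, 0 < a -> a <= b -> ex_RInt (g k) a b).
{ intros k a b Ha Hab. apply ex_RInt_of_continuous; trivial. intros t Ht.
  apply continuous_Rmult; [now apply Rpower_continuous | apply K_weight_continuous]. }
assert (HGk : forall k t, 0 < t -> inner (emb (phi k)) (G t) = c k * g k t).
{ intros k t Ht. unfold G, c, g.
  rewrite inner_scal_r, inner_sym, (inner_K_residual C phi lam Hbasis t u (v t) k (Hv t Ht)).
  ring. }
assert (HGex : forall a b, 0 < a -> a <= b -> ex_RInt G a b).
{ intros a b Ha Hab. apply (ex_RInt_of_continuous (V0 C)); trivial. intros t Ht.
  apply (continuous_scal (V := V0 C)); [now apply Rpower_continuous |].
  apply (continuous_minus (V := V0 C)); [apply continuous_const |].
  now apply minimizer_continuous with u. }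
(* The weak identity tested with [phi k] yields the coefficients of [f]. *)
assert (Hfk : forall k, inner f (emb (phi k)) = c k * m k).
{ intros k. rewrite inner_sym, Hf.
  assert (H1 := is_RInt_gen_K_operator_dual C phi lam Hbasis s Hs u Hu v Hv (phi k)).
  assert (H2 := is_RInt_gen_scal (V := R_NormedModule) _ (c k) _ (Hm k)).
  rewrite <- (is_RInt_gen_unique (V := R_CompleteNormedModule) _ _ H2 : _ = c k * m k).
  symmetry. apply (is_RInt_gen_unique (V := R_CompleteNormedModule)).
  apply (is_RInt_gen_ext (V := R_NormedModule)) with (2 := H1).
  apply filter_prod_0_infty_intro with 1 1; [lra |].
  intros a b Ha Hb t Ht. simpl in Ht. rewrite Rmin_left in Ht by lra.
  apply HGk. lra. }
assert (HIk : forall k a b, 0 < a -> a <= b ->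
  inner (RInt G a b) (emb (phi k)) = c k * RInt (g k) a b).
{ intros k a b Ha Hab. rewrite inner_sym.
  assert (H1 := is_RInt_linear _ _ _ _ _ _ _ (is_linear_inner _ (emb (phi k)))
    (RInt_correct _ _ _ (HGex a b Ha Hab))).
  assert (H2 := is_RInt_scal (V := R_NormedModule) _ _ _ (c k) _
    (RInt_correct _ _ _ (Hgex k a b Ha Hab))).
  apply (is_RInt_unique (V := R_CompleteNormedModule)) in H1.
  apply (is_RInt_unique (V := R_CompleteNormedModule)) in H2.
  rewrite <- H1. etransitivity; [| exact H2].
  apply RInt_ext. intros t Ht. rewrite Rmin_left in Ht by lra. apply HGk. lra. }
assert (FF : Filter (filter_prod (at_right 0) (Rbar_locally p_infty)))
  by typeclasses eauto.
apply (proj2 (filterlimi_locally _ _)). intros eps.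
assert (HL : is_lim_seq (sum_n (fun k => inner f (emb (phi k)) ^ 2)) (norm f ^ 2))
  by exact (Parseval_norm C phi lam Hbasis f).
apply is_lim_seq_spec in HL.
(* [N] depends on [f] and [eps] only: half of [eps ^ 2] goes to the tail of [f], the other half to
   the first modes, of which there are finitely many. *)
destruct (HL (mkposreal (eps ^ 2 / 2) ltac:(destruct eps; simpl; nra))) as [N HN].
specialize (HN N (Nat.le_refl N)). cbn [pos] in HN.
set (SN := sum_n (fun k => inner f (emb (phi k)) ^ 2) N) in HN.
assert (Hfin : filter_prod (at_right 0) (Rbar_locally p_infty) (fun ab =>
  sum_n (fun k => (c k * (RInt (g k) (fst ab) (snd ab) - m k)) ^ 2) N < eps ^ 2 / 2)).
{ apply (filter_sum_sqr_lt _ _ FF c (fun k ab => RInt (g k) (fst ab) (snd ab) - m k)).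
  - intros k e He.
    generalize (proj1 (filterlimi_locally _ _) (Hm k) (mkposreal e He)).
    apply filter_imp. intros ab [I [HI Hball]].
    apply (is_RInt_unique (V := R_CompleteNormedModule)) in HI. rewrite HI. exact Hball.
  - destruct eps; simpl; nra. }
assert (Hpos : filter_prod (at_right 0) (Rbar_locally p_infty)
  (fun ab => 0 < fst ab /\ fst ab <= snd ab)).
{ apply filter_prod_0_infty_intro with 1 1; [lra |]. intros a b Ha Hb. simpl. lra. }
generalize (filter_and _ _ Hfin Hpos). apply filter_imp.
intros [a b] [Hsum [Ha Hab]]. cbn [fst snd] in *.
exists (RInt G a b). split; [now apply (RInt_correct G), HGex |].
apply (norm_compat1 (V := V0 C)).
set (x := minus (RInt G a b) f).
assert (Hxk : forall k, inner x (emb (phi k)) = c k * (RInt (g k) a b - m k)).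
{ intros k. unfold x. rewrite inner_minus_l, HIk, Hfk by assumption. ring. }
(* Since [0 <= RInt (g k) a b <= m k], the error [RInt (g k) a b - m k] is at most [m k] in absolute
   value. *)
assert (Hdom : forall k, inner x (emb (phi k)) ^ 2 <= inner f (emb (phi k)) ^ 2).
{ intros k. rewrite Hxk, Hfk.
  assert (J0 : 0 <= RInt (g k) a b).
  { apply RInt_ge_0; [exact Hab | now apply Hgex |]. intros t Ht. apply Hg0. lra. }
  assert (J1 : RInt (g k) a b <= m k)
    by (apply RInt_le_RInt_gen; [apply Hg0 | apply Hgex | apply Hm | exact Ha | exact Hab]).
  rewrite !Rpow_mult_distr. apply Rmult_le_compat_l; [apply pow2_ge_0 |]. nra. }
assert (Hx := Parseval_tail_le C phi lam Hbasis x f N Hdom).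
rewrite (sum_n_ext _ _ N (fun k => f_equal (fun r => r ^ 2) (Hxk k))) in Hx.
fold SN in Hx. apply Rabs_def2 in HN.
assert (Hx2 : norm x ^ 2 < eps ^ 2).
{ apply Rle_lt_trans with (1 := Hx). lra. }
apply (Rsqr_incrst_0 (norm x) eps);
  [rewrite !Rsqr_pow2; exact Hx2 | apply norm_ge_0 | left; apply cond_pos].
Qed.

Theorem theorem2p2
  (C : InterpolationCouple) (phi : nat -> V1 C) (lam : nat -> R)
  (Hbasis : is_eigenbasis phi lam)
  (s : R) (Hs : 0 < s < 1)
  (u : V0 C) (Hu : in_interpolation_space phi lam s u)
  (v : R -> V1 C) (Hv : forall t : R, 0 < t -> is_K_minimizer t u (v t)) :
  (* equality in the dual of V1, for every u in the interpolation space *)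
  (forall w : V1 C,
     is_RInt_gen
       (fun t => inner (emb w)
                   (scal (Rpower t (- 2 * s - 1)) (minus u (emb (v t)))))
       (at_right 0) (Rbar_locally p_infty)
       (K_operator_dual s u w)) /\
  (* equality in V0: either side exists in V0 iff the other does *)
  (forall f : V0 C,
     is_K_operator s u f <->
     is_RInt_gen
       (fun t => scal (Rpower t (- 2 * s - 1)) (minus u (emb (v t))))
       (at_right 0) (Rbar_locally p_infty) f).
Proof.
assert (Hdual := is_RInt_gen_K_operator_dual C phi lam Hbasis s Hs u Hu v Hv).
split; [exact Hdual |]. intros f. split.
- intros [Hf _]. now apply is_RInt_gen_of_K_operator with phi lam.
(* Pairing the [V0]-valued integral with [emb w] gives the weak integral, whose value is unique. *)
- intros HI. apply is_K_operator_of_inner. intros w.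
  assert (H := is_RInt_gen_linear _ _ _ _ _ _ _ _ _ (is_linear_inner _ (emb w)) HI).
  rewrite <- (is_RInt_gen_unique (V := R_CompleteNormedModule) _ _ H).
  apply (is_RInt_gen_unique (V := R_CompleteNormedModule)). apply Hdual.
Qed.
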